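(* Let $\mathbb F$ be a field, let $\rho\in\mathbb F^{\times}$, let $L=L_{14}(\rho)$ and $G=\operatorname{Aut}(L)$. If $\rho=1$, then $$\Xi(G)=\left\{\begin{pmatrix}1&0&0\\ u-1&u&s\\ v&v&t\end{pmatrix}: u,v,s,t\in\mathbb F,\ ut-vs\ne0\right\},$$ and $G\cong GL_2(\mathbb F)$. If $\rho\ne1$ and either $\operatorname{char}\mathbb F=2$ or $\rho\ne-1$, then $$\text{(B)}\qquad \Xi(G)=\left\{\begin{pmatrix}1&0&0\\ u-1&u&0\\ 0&0&t\end{pmatrix}: u,t\in\mathbb F^{\times}\right\},$$ and $G\cong\mathbb F^{\times}\times\mathbb F^{\times}$. If $\operatorname{char}\mathbb F\ne2$ and $\rho=-1$, then $\Xi(G)$ consists of the matrices in the set on the right-hand side of (B) together with all matrices $$\begin{pmatrix}-1&0&0\\ 1&0&s\\ y&y&0\end{pmatrix},\qquad s,y\in\mathbb F^{\times}.$$ In this case $G$ is a semidirect product of $\mathbb F^{\times}\times\mathbb F^{\times}$ (normal) by a group of order two, and the element of order two interchanges the two multiplicative factors.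
   Context: A left Leibniz algebra over $\mathbb F$ is a vector space with a bilinear product satisfying $[x,[y,z]]=[[x,y],z]+[y,[x,z]]$. For $\rho\in\mathbb F^{\times}$, $L_{14}(\rho)$ is the three-dimensional left Leibniz algebra over $\mathbb F$ with basis $a_1,a_2,a_3$ and nonzero products $[a_1,a_1]=[a_1,a_2]=a_2$, $[a_1,a_3]=\rho a_3$ (all other products of basis elements are zero). $\operatorname{Aut}(L)$ is the group of invertible linear maps $f:L\to L$ with $f([x,y])=[f(x),f(y)]$. $\Xi:\operatorname{Aut}(L)\to GL_3(\mathbb F)$ is the monomorphism sending $f$ to its matrix in the basis $a_1,a_2,a_3$, the $j$-th column being the coordinates of $f(a_j)$. $\mathbb F^{\times}$ is the multiplicative group of $\mathbb F$. *)

(* Defs.v *)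
From HB Require Import structures.
From mathcomp Require Import all_boot all_order all_algebra.
From mathcomp Require Import boolp classical_sets.

Set Implicit Arguments.
Unset Strict Implicit.
Unset Printing Implicit Defensive.

Import GRing.Theory.
Local Open Scope ring_scope.

(* MathComp's {unit R} is only a group for finite R; here R is arbitrary.
   In particular units F is F^* and units 'M[F]_n.+1 is GL_(n.+1)(F). *)
Record units (R : unitRingType) :=
  Units { uval :> R; uvalP : uval \is a GRing.unit }.

HB.instance Definition _ R := [isSub for @uval R].
HB.instance Definition _ R := [Choice of units R by <:].

Section UnitsGroup.
Variable R : unitRingType.
Implicit Types x y z : units R.

Fact units_mul_subproof x y : uval x * uval y \is a GRing.unit.
Proof. by rewrite unitrMl ?uvalP. Qed.
Fact units_inv_subproof x : (uval x)^-1 \is a GRing.unit.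
Proof. by rewrite unitrV uvalP. Qed.

Definition units_one : units R := Units (unitr1 R).
Definition units_mul x y : units R := Units (units_mul_subproof x y).
Definition units_inv x : units R := Units (units_inv_subproof x).

Fact units_mulA : associative units_mul.
Proof. by move=> x y z; apply: val_inj; rewrite /= mulrA. Qed.
Fact units_mul1 : left_id units_one units_mul.
Proof. by move=> x; apply: val_inj; rewrite /= mul1r. Qed.
Fact units_1mul : right_id units_one units_mul.
Proof. by move=> x; apply: val_inj; rewrite /= mulr1. Qed.
Fact units_mulV : left_inverse units_one units_inv units_mul.
Proof. by move=> x; apply: val_inj; rewrite /= mulVr ?uvalP. Qed.
Fact units_Vmul : right_inverse units_one units_inv units_mul.
Proof. by move=> x; apply: val_inj; rewrite /= mulrV ?uvalP. Qed.

HB.instance Definition _ := isGroup.Build (units R)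
  units_mulA units_mul1 units_1mul units_mulV units_Vmul.
End UnitsGroup.

Definition isogroup (G H : groupType) : Prop :=
  exists f : {multiplicative G -> H}, bijective f.

Section SemidirectProduct.
Local Open Scope group_scope.
Local Open Scope classical_set_scope.
Variable G : groupType.
Implicit Types N H : set G.

Definition is_subgroup H : Prop :=
  [/\ H 1, forall x y, H x -> H y -> H (x * y) & forall x, H x -> H x^-1].

Definition is_normal_subgroup N : Prop :=
  is_subgroup N /\ forall g x, N x -> N (g * x * g^-1).

Definition is_semidirect_product N H : Prop :=
  [/\ is_normal_subgroup N, is_subgroup H, N `&` H = [set 1] &
      forall g, exists x y, [/\ N x, H y & g = x * y]].
End SemidirectProduct.

HB.mixin Record isLeftLeibniz (F : fieldType) L of GRing.Lmodule F L := {
  leib : L -> L -> L;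
  leib_linearl : forall z, linear (leib^~ z);
  leib_linearr : forall z, linear (leib z);
  leib_leibniz : forall x y z,
    leib x (leib y z) = leib (leib x y) z + leib y (leib x z)
}.

#[short(type="leftLeibnizType")]
HB.structure Definition LeftLeibniz (F : fieldType) :=
  {L of isLeftLeibniz F L & GRing.Lmodule F L}.

#[short(type="vectLeftLeibnizType")]
HB.structure Definition VectLeftLeibniz (F : fieldType) :=
  {L of isLeftLeibniz F L & Vector F L}.

Section Automorphisms.
Variables (F : fieldType) (L : vectLeftLeibnizType F).

Definition is_leib_aut (f : 'End(L)) : bool :=
  `[< bijective f /\ {morph f : x y / leib x y} >].

Record leibAut := LeibAut { aut_fun :> 'End(L); aut_funP : is_leib_aut aut_fun }.

HB.instance Definition _ := [isSub for aut_fun].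
HB.instance Definition _ := [Choice of leibAut by <:].

Implicit Types f g h : leibAut.

Fact aut_bij f : bijective f. Proof. by have /asboolP[] := aut_funP f. Qed.
Fact aut_morph f : {morph f : x y / leib x y}.
Proof. by have /asboolP[] := aut_funP f. Qed.
Fact aut_lker0 f : lker (aut_fun f) == 0%VS.
Proof. by apply/lker0P/bij_inj/aut_bij. Qed.

Fact aut_one_subproof : is_leib_aut \1%VF.
Proof.
apply/asboolP; split; last by move=> x y; rewrite !lfunE.
by exists id => x; rewrite lfunE.
Qed.

Fact aut_mul_subproof f g : is_leib_aut (f \o g)%VF.
Proof.
apply/asboolP; split; last by move=> x y; rewrite !comp_lfunE !aut_morph.
apply: (@eq_bij _ _ (f \o g)); first exact: bij_comp (aut_bij f) (aut_bij g).
by move=> x; rewrite comp_lfunE.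
Qed.

Fact aut_inv_subproof f : is_leib_aut (f^-1)%VF.
Proof.
have fK := lker0_lfunK (aut_lker0 f); have fVK := lker0_lfunVK (aut_lker0 f).
apply/asboolP; split; first by exists f.
by move=> x y; rewrite -{1}[x]fVK -{1}[y]fVK -aut_morph fK.
Qed.

Definition aut_one := LeibAut aut_one_subproof.
Definition aut_mul f g := LeibAut (aut_mul_subproof f g).
Definition aut_inv f := LeibAut (aut_inv_subproof f).

Fact aut_mulA : associative aut_mul.
Proof. by move=> f g h; apply: val_inj; rewrite /= comp_lfunA. Qed.
Fact aut_mul1 : left_id aut_one aut_mul.
Proof. by move=> f; apply: val_inj; rewrite /= comp_lfun1l. Qed.
Fact aut_1mul : right_id aut_one aut_mul.
Proof. by move=> f; apply: val_inj; rewrite /= comp_lfun1r. Qed.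
Fact aut_mulV : left_inverse aut_one aut_inv aut_mul.
Proof. by move=> f; apply: val_inj; rewrite /= lker0_compVf ?aut_lker0. Qed.
Fact aut_Vmul : right_inverse aut_one aut_inv aut_mul.
Proof. by move=> f; apply: val_inj; rewrite /= lker0_compfV ?aut_lker0. Qed.

HB.instance Definition _ := isGroup.Build leibAut
  aut_mulA aut_mul1 aut_1mul aut_mulV aut_Vmul.
End Automorphisms.

Definition L14 (F : fieldType) (rho : F) : Type := 'cV[F]_3.

Section L14.
Variables (F : fieldType) (rho : F).

HB.instance Definition _ := Vector.on (L14 rho).

(* The basis a_1, a_2, a_3, indexed from 0. *)
Definition L14_basis (i : 'I_3) : L14 rho := delta_mx i 0.
Local Notation a := L14_basis.

Definition L14_table (i j : 'I_3) : L14 rho :=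
  match val i, val j with
  | 0%N, 0%N => a (inord 1)
  | 0%N, 1%N => a (inord 1)
  | 0%N, 2%N => rho *: a (inord 2)
  | _, _ => 0
  end.

Definition L14_mul (x y : L14 rho) : L14 rho :=
  \sum_(i < 3) \sum_(j < 3) (x i 0 * y j 0) *: L14_table i j.

Fact L14_linearl z : linear (L14_mul^~ z).
Proof.
move=> c x y; rewrite /L14_mul scaler_sumr -big_split; apply: eq_bigr => i _ /=.
rewrite scaler_sumr -big_split; apply: eq_bigr => j _ /=.
by rewrite !mxE mulrDl scalerDl scalerA mulrA.
Qed.

Fact L14_linearr z : linear (L14_mul z).
Proof.
move=> c x y; rewrite /L14_mul scaler_sumr -big_split; apply: eq_bigr => i _ /=.
rewrite scaler_sumr -big_split; apply: eq_bigr => j _ /=.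
by rewrite !mxE mulrDr scalerDl scalerA mulrCA.
Qed.

Fact L14_mulE x y : L14_mul x y =
  (x 0 0 * (y 0 0 + y (inord 1) 0)) *: a (inord 1)
  + (rho * x 0 0 * y (inord 2) 0) *: a (inord 2).
Proof.
have e1 : lift ord0 ord0 = inord 1 :> 'I_3 by apply: val_inj; rewrite /= inordK.
have e2 : lift ord0 (lift ord0 ord0) = inord 2 :> 'I_3.
  by apply: val_inj; rewrite /= inordK.
rewrite /L14_mul !big_ord_recl !big_ord0 /L14_table /= !scaler0 !addr0 e1 e2.
by rewrite addrA -scalerDl scalerA -mulrDr [_ * rho]mulrC mulrA.
Qed.

Fact L14_leibniz x y z :
  L14_mul x (L14_mul y z) = L14_mul (L14_mul x y) z + L14_mul y (L14_mul x z).
Proof.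
rewrite !(L14_mulE x, L14_mulE y, L14_mulE _ z) !mxE /= !eqE /= !inordK //=.
rewrite ?(mulr0, mul0r, mulr1, addr0, add0r, scale0r).
congr (_ *: _ + _ *: _); first by rewrite mulrCA.
by rewrite !mulrA; congr (_ * _); rewrite mulrAC [in RHS]mulrAC; congr (_ * _ );
   rewrite -!mulrA; congr (_ * _); rewrite mulrC.
Qed.

HB.instance Definition _ := isLeftLeibniz.Build F (L14 rho)
  L14_linearl L14_linearr L14_leibniz.

Definition Xi_mx (f : leibAut (L14 rho)) : 'M[F]_3 :=
  \matrix_(i, j) (f (L14_basis j) : 'cV[F]_3) i 0.

Fact Xi_mxE (f : leibAut (L14 rho)) (x : L14 rho) : f x = Xi_mx f *m x.
Proof.
have {1}-> : x = \sum_j (x : 'cV_3) j 0 *: a j.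
  rewrite [LHS]matrix_sum_delta; apply: eq_bigr => i _.
  by rewrite big_ord1.
rewrite linear_sum; apply/matrixP=> i k; rewrite ord1 summxE mxE.
by apply: eq_bigr => j _; rewrite linearZ /= !mxE mulrC.
Qed.

Fact Xi_mxM f g : Xi_mx (f * g)%g = Xi_mx f *m Xi_mx g.
Proof.
apply/matrixP => i j; rewrite [LHS]mxE [RHS]mxE /= comp_lfunE Xi_mxE mxE.
by apply: eq_bigr => k _; rewrite [Xi_mx g k j]mxE.
Qed.

Fact Xi_mx1 : Xi_mx 1%g = 1%:M.
Proof. by apply/matrixP => i j; rewrite !mxE lfunE /= mxE eqxx andbT. Qed.

Fact Xi_subproof f : Xi_mx f \is a GRing.unit.
Proof.
apply/unitrP; exists (Xi_mx f^-1%g).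
by split; rewrite -[_ * _]Xi_mxM ?mulVg ?mulgV Xi_mx1.
Qed.

Definition Xi f : units 'M[F]_3 := Units (Xi_subproof f).

Fact Xi_is_multiplicative : {morph Xi : f g / (f * g)%g}.
Proof. by move=> f g; apply: val_inj; rewrite /= Xi_mxM. Qed.

HB.instance Definition _ := isMultiplicative.Build
  (leibAut (L14 rho)) (units 'M[F]_3) Xi Xi_is_multiplicative.

Fact Xi_inj : injective Xi.
Proof.
move=> f g /(congr1 val) /= eq_fg; apply: val_inj; apply/lfunP => x.
by rewrite !Xi_mxE eq_fg.
Qed.
End L14.

Definition mx3 (F : fieldType) (s : seq (seq F)) : 'M[F]_3 :=
  \matrix_(i, j) (nth [::] s i)`_j.

(* Main.v *)
(* Left multiplication by x in L_14(rho) is x_1 D, where D is the left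
   multiplication by a_1. Hence an invertible M is an automorphism iff
   x_1 (M D) = (M x)_1 (D M) for all x, i.e. iff the first row of M is (e, 0, 0)
   and M D = e (D M). Comparing entries, either e = 1, or the diagonal entries
   M_22, M_33 vanish and then e = rho = -1. *)

Require Import Defs.
From HB Require Import structures.
From mathcomp Require Import all_boot all_order all_algebra ring.
From mathcomp Require Import boolp classical_sets.

Set Implicit Arguments.
Unset Strict Implicit.
Unset Printing Implicit Defensive.

Import GRing.Theory.
Local Open Scope ring_scope.
Local Open Scope classical_set_scope.

(** * Comparing groups through injective maps into a common set *)

Section Lift.
Local Open Scope group_scope.
Variables (G H : groupType) (K : Type) (op : K -> K -> K).
Variables (f : G -> K) (k : H -> K).
Hypotheses (fM : {morph f : x y / x * y >-> op x y}) (f_inj : injective f).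
Hypothesis kM : {morph k : x y / x * y >-> op x y}.

(** Preimages under the injective [f] are unique, so any choice of them respects products. Only an
    operation is required on [K], so that matrix-valued maps may land in all of ['M[F]_3] under [*m]
    instead of in a group. *)
Lemma lift_multiplicative : (forall h, exists g, f g = k h) ->
  exists i : {multiplicative H -> G}, forall h, f (i h) = k h.
Proof.
move=> /choice[i iE].
have iM : {morph i : x y / x * y}.
  by move=> x y; apply: f_inj; rewrite fM !iE kM.
pose iM' := isMultiplicative.Build _ _ i iM.
by exists (HB.pack_for {multiplicative H -> G} i iM').
Qed.
End Lift.

(** Equal images allow each embedding to be lifted through the other, and injectivity makes the two
    lifts mutually inverse. An isomorphism thus comes for free once $\Xi(G)$ is known to be the
    image of a matrix embedding. *)
Lemma isogroup_eq_range (G H : groupType) (K : Type) (op : K -> K -> K)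
    (f : G -> K) (k : H -> K) :
  {morph f : x y / (x * y)%g >-> op x y} -> injective f ->
  {morph k : x y / (x * y)%g >-> op x y} -> injective k ->
  range f = range k -> isogroup G H.
Proof.
move=> fM f_inj kM k_inj fk.
have [|i iE] := lift_multiplicative kM k_inj fM.
  move=> g; have: range f (f g) by exists g.
  by rewrite fk => -[h _]; exists h.
have [|j jE] := lift_multiplicative fM f_inj kM.
  move=> h; have: range k (k h) by exists h.
  by rewrite -fk => -[g _]; exists g.
exists i; exists j => x; first by apply: f_inj; rewrite jE.
by apply: k_inj; rewrite iE.
Qed.

Lemma uval_inj (R : unitRingType) : injective (@uval R).
Proof. exact: val_inj. Qed.

Lemma det_mx2 (R : comPzRingType) (M : 'M[R]_2) :
  \det M = M 0 0 * M 1 1 - M 0 1 * M 1 0.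
Proof.
rewrite (expand_det_row _ 0) !big_ord_recl big_ord0 /cofactor !det_mx11 !mxE /=.
rewrite expr0 expr1 mul1r mulN1r addr0 mulrN.
by congr (_ * M _ _ - M _ _ * M _ _); apply: val_inj.
Qed.

(** * Entrywise calculus for explicit 3x3 matrices *)

Section Mx3.
Variable F : fieldType.

Lemma mx3_eta (M : 'M[F]_3) :
  M = mx3 [:: [:: M 0 0; M 0 1; M 0 2];
              [:: M 1 0; M 1 1; M 1 2];
              [:: M 2 0; M 2 1; M 2 2]].
Proof.
apply/matrixP => -[[|[|[|//]]] ?] [[|[|[|//]]] ?]; rewrite !mxE /=;
  congr (M _ _); exact: val_inj.
Qed.

Lemma mx3_1 :
  1%:M = mx3 [:: [:: 1; 0; 0]; [:: 0; 1; 0]; [:: 0; 0; 1]] :> 'M[F]_3.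
Proof.
by apply/matrixP => -[[|[|[|//]]] ?] [[|[|[|//]]] ?]; rewrite !mxE.
Qed.

Variables (a11 a12 a13 a21 a22 a23 a31 a32 a33 : F).
Variables (b11 b12 b13 b21 b22 b23 b31 b32 b33 : F).

Let A := [:: [:: a11; a12; a13]; [:: a21; a22; a23]; [:: a31; a32; a33]].
Let B := [:: [:: b11; b12; b13]; [:: b21; b22; b23]; [:: b31; b32; b33]].

Lemma mx3_inj : mx3 A = mx3 B -> A = B.
Proof.
move=> /matrixP AB.
have E i j : (nth [::] A (i : 'I_3))`_(j : 'I_3) = (nth [::] B i)`_j.
  by have := AB i j; rewrite !mxE.
by rewrite /A /B; congr [:: [:: _; _; _]; [:: _; _; _]; [:: _; _; _]];
  [exact: (E 0 0)|exact: (E 0 1)|exact: (E 0 2)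
  |exact: (E 1 0)|exact: (E 1 1)|exact: (E 1 2)
  |exact: (E 2 0)|exact: (E 2 1)|exact: (E 2 2)].
Qed.

Lemma mulmx3 : mx3 A *m mx3 B = mx3
  [:: [:: a11 * b11 + a12 * b21 + a13 * b31;
          a11 * b12 + a12 * b22 + a13 * b32;
          a11 * b13 + a12 * b23 + a13 * b33];
      [:: a21 * b11 + a22 * b21 + a23 * b31;
          a21 * b12 + a22 * b22 + a23 * b32;
          a21 * b13 + a22 * b23 + a23 * b33];
      [:: a31 * b11 + a32 * b21 + a33 * b31;
          a31 * b12 + a32 * b22 + a33 * b32;
          a31 * b13 + a32 * b23 + a33 * b33]].
Proof.
apply/matrixP => -[[|[|[|//]]] ?] [[|[|[|//]]] ?];
  by rewrite mxE !big_ord_recl big_ord0 !mxE /= addr0 addrA.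
Qed.

Lemma scalemx3 c : c *: mx3 A = mx3
  [:: [:: c * a11; c * a12; c * a13];
      [:: c * a21; c * a22; c * a23];
      [:: c * a31; c * a32; c * a33]].
Proof.
by apply/matrixP => -[[|[|[|//]]] ?] [[|[|[|//]]] ?]; rewrite !mxE /=.
Qed.

Lemma det_mx3_row0 :
  \det (mx3 [:: [:: a11; 0; 0]; [:: a21; a22; a23]; [:: a31; a32; a33]])
  = a11 * (a22 * a33 - a32 * a23).
Proof.
rewrite (expand_det_row _ 0) !big_ord_recl big_ord0 /cofactor !mxE /=.
by rewrite !mul0r !addr0 expr0 mul1r det_mx2 !mxE /= [a32 * _]mulrC.
Qed.
End Mx3.

(** * The matrices of automorphisms of $L_{14}(\rho)$ *)

Section L14Aut.
Variables (F : fieldType) (rho : F).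

(** The matrix $D$ of left multiplication by $a_1$. *)
Definition L14_ad : 'M[F]_3 :=
  mx3 [:: [:: 0; 0; 0]; [:: 1; 1; 0]; [:: 0; 0; rho]].

Lemma leibE (x y : L14 rho) :
  leib x y = (x : 'cV_3) 0 0 *: (L14_ad *m (y : 'cV_3)) :> 'cV_3.
Proof.
rewrite [leib x y]L14_mulE; apply/matrixP => i j; rewrite !ord1 {j} !mxE.
have e1 : inord 1 = 1 :> 'I_3 by apply: val_inj; rewrite /= inordK.
have e2 : inord 2 = 2 :> 'I_3 by apply: val_inj; rewrite /= inordK.
have l1 : lift ord0 ord0 = 1 :> 'I_3 by apply: val_inj.
have l2 : lift ord0 (lift ord0 ord0) = 2 :> 'I_3 by apply: val_inj.
rewrite !big_ord_recl big_ord0 !mxE l1 l2 e1 e2.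
rewrite -[ord0]/(0 : 'I_3).
by case: i => [[|[|[|//]]] ?] /=; ring.
Qed.

Lemma Xi_mx_inj : injective (@Xi_mx F rho).
Proof. by move=> f g fg; apply: Xi_inj; apply: val_inj. Qed.

Lemma Xi_imageP (M : 'M[F]_3) : (exists g : leibAut (L14 rho), Xi_mx g = M) <->
  M \in unitmx /\ forall x : 'cV_3,
     x 0 0 *: (M *m L14_ad) = (M *m x) 0 0 *: (L14_ad *m M).
Proof.
split=> [[g <-]|[uM homM]].
  split=> [|x]; first exact: Xi_subproof.
  apply/row_matrixP => i; apply/rowP => j.
  (* The morphism law at $y = a_j$ is column $j$ of the matrix identity. *)
  have /matrixP/(_ i 0) := aut_morph g x (L14_basis rho j).
  by rewrite leibE !Xi_mxE leibE -scalemxAr !mulmxA !scalemxAl -!colE !mxE.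
pose fM : 'End(L14 rho) := linfun (mulmx M : L14 rho -> L14 rho).
have fE z : fM z = M *m z by rewrite lfunE.
have fP : is_leib_aut fM.
  apply/asboolP; split=> [|x y].
    by exists (mulmx (invmx M)) => x; rewrite fE ?mulKmx ?mulKVmx.
  by rewrite fE !leibE !fE -scalemxAr !mulmxA [LHS]scalemxAl homM -scalemxAl.
exists (LeibAut fP); apply/matrixP => i j.
by rewrite mxE /= fE -colE mxE.
Qed.

(** Both sides are linear in [x], so the three basis vectors suffice; on them $x_1$ is 1, 0, 0 and
    $(Mx)_1$ is [a11], [a12], [a13]. *)
Lemma mx3_hom (a11 a12 a13 a21 a22 a23 a31 a32 a33 : F) :
  let M := mx3 [:: [:: a11; a12; a13];
                   [:: a21; a22; a23];
                   [:: a31; a32; a33]] in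
  (forall x : 'cV_3,
     x 0 0 *: (M *m L14_ad) = (M *m x) 0 0 *: (L14_ad *m M)) <->
  [/\ M *m L14_ad = a11 *: (L14_ad *m M), a12 *: (L14_ad *m M) = 0 &
      a13 *: (L14_ad *m M) = 0].
Proof.
move=> M.
have M0x x : (M *m x) 0 0 = a11 * x 0 0 + a12 * x 1 0 + a13 * x 2 0 :> F.
  have l1 : lift ord0 ord0 = 1 :> 'I_3 by apply: val_inj.
  have l2 : lift ord0 (lift ord0 ord0) = 2 :> 'I_3 by apply: val_inj.
  by rewrite mxE !big_ord_recl big_ord0 !mxE l1 l2 /= addr0 addrA.
split=> [homM|[hom1 hom2 hom3] x]; last first.
  by rewrite M0x !scalerDl hom1 scalerA [_ * a11]mulrC ![_ * x _ _]mulrC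
    -!scalerA hom2 hom3 !scaler0 !addr0.
split; [have := homM (delta_mx 0 0)|have := homM (delta_mx 1 0)
       |have := homM (delta_mx 2 0)]; rewrite M0x !mxE /=.
- by rewrite mulr1 !mulr0 !addr0 scale1r.
- by rewrite mulr1 !mulr0 addr0 add0r scale0r.
- by rewrite mulr1 !mulr0 !add0r scale0r.
Qed.

Hypothesis rho_neq0 : rho != 0.

(** The equations [(rho - 1) * s = 0] and [(rho - 1) * v = 0] serve all [rho] at once: [s] and [v]
    are free if [rho = 1] and vanish otherwise. In the second family, [rho != 1] beside [rho = -1]
    rules out characteristic 2. *)
Lemma Xi_image_cases (M : 'M[F]_3) :
  (exists g : leibAut (L14 rho), Xi_mx g = M) <->
  (exists u v s t,
     [/\ u * t - v * s != 0, (rho - 1) * s = 0, (rho - 1) * v = 0 &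
     M = mx3 [:: [:: 1; 0; 0]; [:: u - 1; u; s]; [:: v; v; t]]]) \/
  [/\ rho = -1, rho != 1 & exists s y, [/\ s != 0, y != 0 &
     M = mx3 [:: [:: -1; 0; 0]; [:: 1; 0; s]; [:: y; y; 0]]]].
Proof.
rewrite Xi_imageP; split; last first.
  case=> [[u [v [s [t [D s0 v0 ->]]]]]|[rN1 _ [s [y [s0 y0 ->]]]]].
    rewrite unitmxE unitfE det_mx3_row0 mul1r; split=> //.
    have fixed x : (rho - 1) * x = 0 -> rho * x = x.
      by move/eqP; rewrite mulrBl mul1r subr_eq0 => /eqP.
    have [rs rv] := (fixed s s0, fixed v v0).
    apply/mx3_hom; rewrite !scale0r scale1r; split=> //.
    rewrite /L14_ad !mulmx3 !(mulr0, mul0r, mulr1, mul1r, addr0, add0r).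
    by rewrite [1 + _]addrC subrK [s * _]mulrC [t * _]mulrC rs rv.
  rewrite unitmxE unitfE det_mx3_row0; split.
    by rewrite mul0r sub0r mulrNN mul1r mulf_neq0.
  apply/mx3_hom; rewrite !scale0r; split=> //.
  rewrite /L14_ad !mulmx3 scalemx3 rN1; congr mx3.
  by congr [:: [:: _; _; _]; [:: _; _; _]; [:: _; _; _]]; ring.
(* The rows of [M] become [(e, a12, a13)], [(b, u, s)] and [(c, v, t)]. *)
rewrite [M]mx3_eta; move: (M 0 0) (M 0 1) (M 0 2) (M 1 0) (M 1 1).
move: (M 1 2) (M 2 0) (M 2 1) (M 2 2) => s c v t e a12 a13 b u.
set N := mx3 _ => -[uN /mx3_hom[hom1 hom2 hom3]].
(* As [N] is invertible, $DN = 0$ would force $D = 0$. Hence [hom2] and [hom3] kill [a12] and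
   [a13]. *)
have adN_neq0 : L14_ad *m N != 0.
  apply/eqP => adN0; have := mulmxK uN L14_ad; rewrite adN0 mul0mx.
  by move/matrixP/(_ 1 0); rewrite !mxE /= => /esym/eqP; rewrite oner_eq0.
have a12_0 : a12 = 0.
  by move/eqP: hom2; rewrite scaler_eq0 (negPf adN_neq0) orbF => /eqP.
have a13_0 : a13 = 0.
  by move/eqP: hom3; rewrite scaler_eq0 (negPf adN_neq0) orbF => /eqP.
move: uN hom1; rewrite /N a12_0 a13_0.
rewrite unitmxE unitfE det_mx3_row0 mulf_eq0 negb_or => /andP[e0 D].
rewrite /L14_ad !mulmx3 scalemx3 !(mulr0, mul0r, mulr1, mul1r, addr0, add0r).
(* The nonzero entries of $MD = e\,DM$ give $u = e(e+b)$, $u = eu$, $s\rho = es$, $v = e\rho c$, $v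
   = e\rho v$ and $t\rho = e\rho t$. *)
case/mx3_inj=> ub uu sE vc vv tE.
have {}tE : t = e * t by apply: (mulIf rho_neq0); rewrite tE mulrCA mulrC.
have [e1|e1] := eqVneq e 1.
  move: sE ub vc vv; rewrite e1 !mul1r => sE ub vc vv; left.
  have cv : c = v by apply: (mulfI rho_neq0); rewrite -vc.
  exists u, v, s, t; split; first exact: D.
  - by rewrite mulrBl mul1r mulrC sE subrr.
  - by rewrite mulrBl mul1r -vv subrr.
  - by rewrite cv ub [1 + b]addrC addrK.
(* For $e \ne 1$ this gives $u = t = 0$, so the nonzero determinant forces $v, s \ne 0$. Then [sE]
   yields $\rho = e$ and [vv] yields $e^2 = 1$. *)
have only0 x : x = e * x -> x = 0.
  by move=> /eqP; rewrite -subr_eq0 -{1}[x]mul1r -mulrBl mulf_eq0 subr_eq0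
    eq_sym (negPf e1) => /eqP.
move: D ub; rewrite (only0 u uu) (only0 t tE) mulr0 sub0r oppr_eq0 mulf_eq0.
rewrite negb_or => /andP[v0 s0] /esym/eqP; rewrite mulf_eq0 (negPf e0) /=.
rewrite addrC addr_eq0 => /eqP b_e.
have rho_e : rho = e by apply: (mulfI s0); rewrite sE mulrC.
have eN1 : e = -1.
  have /eqP : e ^+ 2 = 1 by apply: (mulIf v0); rewrite mul1r {2}vv rho_e mulrA.
  by rewrite sqrf_eq1 (negPf e1) => /eqP.
have cv : c = v by rewrite vc rho_e eN1 !mulN1r opprK.
right; split; rewrite ?rho_e //; exists s, v.
by rewrite b_e cv eN1 opprK.
Qed.
End L14Aut.

(** * Matrix models of $GL_2$ and of the torus *)

Section Embeddings.
Variable F : fieldType.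

(** The map that fixes $a_1 - a_2$ and acts as [A] on the span of $a_2, a_3$, which explains why it
    is multiplicative in [A]. *)
Definition GL2_mx (A : units 'M[F]_2) : 'M[F]_3 :=
  mx3 [:: [:: 1;              0;          0];
          [:: uval A 0 0 - 1; uval A 0 0; uval A 0 1];
          [:: uval A 1 0;     uval A 1 0; uval A 1 1]].

Lemma GL2_mxM : {morph GL2_mx : A B / (A * B)%g >-> A *m B}.
Proof.
move=> A B.
have mulE i j :
    uval (A * B)%g i j = uval A i 0 * uval B 0 j + uval A i 1 * uval B 1 j.
  have l1 : lift ord0 ord0 = 1 :> 'I_2 by apply: val_inj.
  by rewrite [uval _]/= mxE !big_ord_recl big_ord0 addr0 l1.
rewrite /GL2_mx mulmx3 !mulE; congr mx3.
by congr [:: [:: _; _; _]; [:: _; _; _]; [:: _; _; _]]; ring.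
Qed.

Lemma GL2_mx_inj : injective GL2_mx.
Proof.
move=> A B /mx3_inj[_ A00 A01 A10 _ A11]; apply/uval_inj/matrixP => i j.
have ord2 (k : 'I_2) : k = 0 \/ k = 1.
  by case: k => -[|[|//]] ?; [left|right]; apply: val_inj.
by case: (ord2 i) => ->; case: (ord2 j) => ->.
Qed.

(** The same construction for a diagonal 2x2 matrix. *)
Definition torus_mx (p : units F * units F) : 'M[F]_3 :=
  mx3 [:: [:: 1;            0;        0];
          [:: uval p.1 - 1; uval p.1; 0];
          [:: 0;            0;        uval p.2]].

Lemma torus_mxM : {morph torus_mx : p q / (p * q)%g >-> p *m q}.
Proof.
move=> [p1 p2] [q1 q2]; rewrite /torus_mx mulmx3 /=; congr mx3.
by congr [:: [:: _; _; _]; [:: _; _; _]; [:: _; _; _]]; ring.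
Qed.

Lemma torus_mx_inj : injective torus_mx.
Proof.
by move=> [p1 p2] [q1 q2] /mx3_inj[_ /uval_inj-> /uval_inj->].
Qed.

Lemma range_GL2_mx : range GL2_mx =
  [set M | exists u v s t : F, u * t - v * s != 0 /\
     M = mx3 [:: [:: 1; 0; 0]; [:: u - 1; u; s]; [:: v; v; t]]].
Proof.
apply/seteqP; split=> [_ [A _ <-]|M [u [v [s [t [D ->]]]]]] /=.
  exists (uval A 0 0), (uval A 1 0), (uval A 0 1), (uval A 1 1); split=> //.
  rewrite [uval A 1 0 * _]mulrC -det_mx2 -unitfE -unitmxE; exact: uvalP.
pose A : 'M[F]_2 := \matrix_(i, j) (nth [::] [:: [:: u; s]; [:: v; t]] i)`_j.
have uA : A \is a GRing.unit.
  rewrite -[_ \is a _]/(A \in unitmx) unitmxE unitfE det_mx2 !mxE /=.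
  by rewrite [s * _]mulrC.
by exists (Units uA); rewrite // /GL2_mx !mxE.
Qed.

Lemma range_torus_mx : range torus_mx =
  [set M | exists u t : F, [/\ u != 0, t != 0 &
     M = mx3 [:: [:: 1; 0; 0]; [:: u - 1; u; 0]; [:: 0; 0; t]]]].
Proof.
apply/seteqP; split=> [_ [[p q] _ <-]|M [u [t [u0 t0 ->]]]] /=.
  by exists (uval p), (uval q); split; rewrite -?unitfE ?uvalP.
by rewrite -unitfE in u0; rewrite -unitfE in t0; exists (Units u0, Units t0).
Qed.
End Embeddings.

(** * The three cases of $\rho$ and the semidirect decomposition *)

Theorem theorem5p1 (F : fieldType) (rho : F) (rho_neq0 : rho != 0) :
  let G := leibAut (L14 rho) in
  let XiG : set 'M[F]_3 := [set uval (Xi g) | g in [set: G]] in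
  let setB : set 'M[F]_3 :=
    [set M | exists u t : F, [/\ u != 0, t != 0 &
       M = mx3 [:: [:: 1;     0; 0];
                   [:: u - 1; u; 0];
                   [:: 0;     0; t]]]] in
  [/\ rho = 1 ->
        XiG = [set M | exists u v s t : F, u * t - v * s != 0 /\
                 M = mx3 [:: [:: 1;     0; 0];
                             [:: u - 1; u; s];
                             [:: v;     v; t]]]
        /\ isogroup G (units 'M[F]_2),
      rho != 1 -> 2%N \in [pchar F] \/ rho != -1 ->
        XiG = setB /\ isogroup G (units F * units F)%type
    & 2%N \notin [pchar F] -> rho = -1 ->
        XiG = setB `|`
              [set M | exists s y : F, [/\ s != 0, y != 0 &
                 M = mx3 [:: [:: -1; 0; 0];
                             [:: 1;  0; s];
                             [:: y;  y; 0]]]]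
        /\ exists (i : {multiplicative (units F * units F)%type -> G}) (tau : G),
             [/\ injective i, tau != 1%g, (tau * tau)%g = 1%g,
                 is_semidirect_product (range i) [set 1%g; tau] &
                 forall p q : units F, (tau * i (p, q) * tau^-1)%g = i (q, p)]].
Proof.
move=> G XiG setB.
have XiGP M : XiG M <-> exists g : G, Xi_mx g = M.
  by split=> [[g _ <-]|[g <-]]; exists g.
have Xi_inj := @Xi_mx_inj F rho; have XiM := @Xi_mxM F rho.
have torus_or_swap M : rho != 1 -> (XiG M <-> setB M \/
  rho = -1 /\ exists s y, [/\ s != 0, y != 0 &
     M = mx3 [:: [:: -1; 0; 0]; [:: 1; 0; s]; [:: y; y; 0]]]).
  move=> rho1; rewrite XiGP Xi_image_cases //.
  have r1 : rho - 1 != 0 by rewrite subr_eq0.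
  split=> [[[u [v [s [t [D /eqP s0 /eqP v0 ->]]]]]|[]]|].
  - move: s0 v0 D; rewrite !mulf_eq0 !(negPf r1) /= => /eqP-> /eqP->.
    by rewrite mulr0 subr0 mulf_eq0 negb_or => /andP[u0 t0]; left; exists u, t.
  - by right.
  - case=> [[u [t [u0 t0 ->]]]|[? ?]]; last by right.
    by left; exists u, 0, 0, t; rewrite !mulr0 subr0 mulf_neq0.
split=> [rho1|rho1 rhoN1|char2 rhoN1].
- have XiE : XiG = range (@GL2_mx F).
    rewrite range_GL2_mx; apply/seteqP.
    split=> M; rewrite XiGP Xi_image_cases //.
      case=> [[u [v [s [t [D _ _ ->]]]]]|[_]]; last by rewrite rho1 eqxx.
      by exists u, v, s, t.
    case=> [u [v [s [t [D ->]]]]]; left; exists u, v, s, t.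
    by rewrite rho1 subrr !mul0r.
  split; first by rewrite XiE range_GL2_mx.
  exact: (isogroup_eq_range XiM Xi_inj (@GL2_mxM F) (@GL2_mx_inj F) XiE).
- have XiE : XiG = range (@torus_mx F).
    rewrite range_torus_mx; apply/seteqP; split=> M; rewrite torus_or_swap //.
      (* The second family needs [rho = -1]; in characteristic 2 this would read [rho = 1]. *)
      case=> // -[rN1 _]; case: rhoN1 => [char2|]; last by rewrite rN1 eqxx.
      by move: rho1; rewrite rN1 oppr_pchar2 ?eqxx.
    by left.
  split; first by rewrite XiE range_torus_mx.
  exact: (isogroup_eq_range XiM Xi_inj (@torus_mxM F) (@torus_mx_inj F) XiE).
have N1_neq1 : -1 != 1 :> F.
  rewrite eq_sym -subr_eq0 opprK; apply: contraNneq char2 => two0.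
  by apply/andP; split=> //; apply/eqP.
have rho1 : rho != 1 by rewrite rhoN1.
split; first by apply/seteqP; split=> M; rewrite torus_or_swap //=; case; tauto.
have [|i iE] := lift_multiplicative XiM Xi_inj (@torus_mxM F).
  move=> p; apply/XiGP/torus_or_swap => //; left.
  by rewrite -[setB]range_torus_mx; exists p.
(* The member $s = y = 1$ of the second family: it negates $a_1 - a_2$ and exchanges $a_2$ and
   $a_3$. It is therefore an involution, and conjugation by it swaps the two torus coordinates. *)
pose T : 'M[F]_3 := mx3 [:: [:: -1; 0; 0]; [:: 1; 0; 1]; [:: 1; 1; 0]].
have [tau tauE] : exists g : G, Xi_mx g = T.
  apply/XiGP/torus_or_swap => //; right; split=> //.
  by exists 1, 1; rewrite oner_eq0.
have i_inj : injective i by move=> p q pq; apply: torus_mx_inj; rewrite -!iE pq.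
(* The top left entries are 1 and -1. *)
have not_tau p : i p != tau.
  apply/eqP => /(congr1 (@Xi_mx F rho)); rewrite iE tauE => /mx3_inj[/esym/eqP].
  by rewrite (negPf N1_neq1).
have i1 : i 1%g = 1%g by apply: (mulgI (i 1%g)); rewrite -gmulfM !mulg1.
have iV p : i p^-1%g = (i p)^-1%g.
  by apply: (mulgI (i p)); rewrite -gmulfM !mulgV.
have tau2 : (tau * tau)%g = 1%g.
  apply: Xi_inj; rewrite XiM tauE Xi_mx1 mx3_1 mulmx3; congr mx3.
  by congr [:: [:: _; _; _]; [:: _; _; _]; [:: _; _; _]]; ring.
have swap p q : (tau * i (p, q) * tau^-1)%g = i (q, p).
  apply: (canLR (mulgK _)).
  apply: Xi_inj; rewrite !XiM !iE tauE /torus_mx !mulmx3 /=; congr mx3.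
  by congr [:: [:: _; _; _]; [:: _; _; _]; [:: _; _; _]]; ring.
have tauV : (tau^-1)%g = tau by apply: (mulgI tau); rewrite mulgV.
have dec g : exists p y, [/\ [set 1%g; tau] y & g = (i p * y)%g].
  have /(torus_or_swap _ rho1)[] : XiG (Xi_mx g) by apply/XiGP; exists g.
    rewrite -[setB]range_torus_mx => -[p _ pE].
    by exists p, 1%g; split; [left|apply: Xi_inj; rewrite mulg1 iE].
  case=> _ [s [y [s0 y0 gE]]].
  rewrite -unitfE in s0; rewrite -unitfE in y0.
  (* The matrix with parameters [s], [y] is [torus_mx (s, y) *m T]. *)
  exists (Units s0, Units y0), tau; split; first by right.
  apply: Xi_inj; rewrite XiM iE tauE gE /torus_mx !mulmx3; congr mx3.
  by congr [:: [:: _; _; _]; [:: _; _; _]; [:: _; _; _]]; rewrite /=; ring.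
exists i, tau; split=> //; first by rewrite eq_sym -i1.
split.
- split; first split.
  + by exists 1%g.
  + by move=> _ _ [p _ <-] [q _ <-]; exists (p * q)%g => //; rewrite gmulfM.
  + by move=> _ [p _ <-]; exists p^-1%g => //; rewrite iV.
  (* With $g = i(p)\,y$, conjugation by $y \in \{1, \tau\}$ fixes or swaps the coordinates, and that
     by $i(p)$ stays in the image of [i]. *)
  + move=> g _ [[q1 q2] _ <-]; have [p [_ [[->|->] ->]]] := dec g.
      by rewrite mulg1; exists (p * (q1, q2) * p^-1)%g; rewrite // !gmulfM iV.
    exists (p * (q2, q1) * p^-1)%g => //.
    by rewrite !gmulfM iV -swap invgM !mulgA.
- split; first by left.
  + by move=> _ _ [->|->] [->|->]; rewrite ?mulg1 ?mul1g ?tau2; by [left|right].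
  + by move=> _ [->|->]; rewrite ?invg1 ?tauV; by [left|right].
- apply/seteqP; split=> [_ [[p _ <-] [//|/eqP]]|_ ->].
    by rewrite (negPf (not_tau p)).
  by split; [exists 1%g|left].
- move=> g; have [p [y [Hy ->]]] := dec g.
  by exists (i p), y; split=> //; exists p.
Qed.
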